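(* Let $\mathcal{V}$ be a variety of $\Omega$-algebras satisfying an identity $t\approx u$, where $t,u$ are $n$-ary $\Omega$-terms with $n\neq 0$, and let $\mathcal{S}\subseteq\mathcal{SV}$ be a variety of semilattice ordered algebras such that for every $(A,\Omega,+)\in\mathcal{S}$ the word operation $t\colon A^n\to A$ distributes over the operation $+$. Then the identity $t\approx u$ is satisfied in $\mathcal{S}$ if and only if for every $(A,\Omega,+)\in\mathcal{S}$ the word operation $u\colon A^n\to A$ distributes over the operation $+$.
   Context: Fix a finitary type $\tau\colon\Omega\to\mathbb{N}^+$ (all basic operations have positive arity; $\Omega$ may be infinite). A semilattice ordered algebra is an algebra $(A,\Omega,+)$ such that $(A,\Omega)$ is an algebra of type $\tau$, $(A,+)$ is a (join) semilattice, and each operation in $\Omega$ distributes over $+$. Here an $n$-ary operation $f\colon A^n\to A$ distributes over $+$ if for each $1\le i\le n$ and all elements of $A$, $f(x_1,\ldots,x_i+y_i,\ldots,x_n)=f(x_1,\ldots,x_i,\ldots,x_n)+f(x_1,\ldots,y_i,\ldots,x_n)$. The word operation of a term $t$ on $A$ is the term operation it induces on $(A,\Omega)$. For $X\subseteq A$, $(\langle X\rangle_\Omega,\Omega)$ denotes the subalgebra of the reduct $(A,\Omega)$ generated by $X$ (using only the operations in $\Omega$), called the full $\Omega$-subreduct relative to $X$. For a variety $\mathcal{V}$ of algebras of type $\tau$, $\mathcal{SV}$ denotes the class of all semilattice ordered algebras $(A,\Omega,+)$ for which there exists a set $X$ of generators of $(A,\Omega,+)$ such that $(\langle X\rangle_\Omega,\Omega)\in\mathcal{V}$.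 *)

(* Defs.v *)
From mathcomp Require Import all_boot.

Set Implicit Arguments.
Unset Strict Implicit.
Unset Printing Implicit Defensive.

(** * Universal algebra over a finitary type without constants *)

Record signature := Signature {
  symbol :> Type;
  arity : symbol -> nat;
  arity_gt0 : forall f, 0 < arity f
}.

(** Carriers may be empty. As there are no constants, the empty algebra is a
    subalgebra of every algebra and satisfies every identity and every
    distributive law vacuously, so the convention of nonempty carriers would
    make no difference to the notions below. *)
Record algebra (Sg : signature) := Algebra {
  carrier :> Type;
  interp : forall f : Sg, ('I_(arity f) -> carrier) -> carrier
}.

Inductive term (Sg : signature) (n : nat) : Type :=
| Var of 'I_n
| App (f : Sg) of ('I_(arity f) -> term Sg n).

Fixpoint term_op (Sg : signature) (A : algebra Sg) n (t : term Sg n)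
    (v : 'I_n -> A) : A :=
  match t with
  | Var i => v i
  | App f args => interp (fun j => term_op (args j) v)
  end.
Arguments term_op {Sg} A {n} t v.

Definition satisfies (Sg : signature) (A : algebra Sg) n (t u : term Sg n) :=
  forall v : 'I_n -> A, term_op A t v = term_op A u v.

Definition class_satisfies (Sg : signature) (K : algebra Sg -> Prop) n
    (t u : term Sg n) :=
  forall A, K A -> satisfies A t u.

Definition variety (Sg : signature) (K : algebra Sg -> Prop) :=
  exists E : forall n, term Sg n -> term Sg n -> Prop,
    forall A, K A <-> forall n (t u : term Sg n), E n t u -> satisfies A t u.

Inductive generated (Sg : signature) (A : algebra Sg) (X : A -> Prop) :
    A -> Prop :=
| gen_base x : X x -> generated X x
| gen_op (f : Sg) (args : 'I_(arity f) -> A) :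
    (forall j, generated X (args j)) -> generated X (interp args).

Definition generated_subalgebra (Sg : signature) (A : algebra Sg)
    (X : A -> Prop) : algebra Sg :=
  @Algebra Sg {x : A | generated X x}
    (fun f args => exist _ (interp (fun j => sval (args j)))
                           (gen_op (fun j => svalP (args j)))).

Definition generates (Sg : signature) (A : algebra Sg) (X : A -> Prop) :=
  forall a, generated X a.

(** * Semilattice ordered algebras *)

(** Algebras [(A, Omega, +)] are algebras of the type extending [Omega] by one
    binary symbol, [None], for [+]. *)
Definition join_arity (Sg : signature) (f : option Sg) : nat :=
  if f is Some g then arity g else 2.

Lemma join_arity_gt0 (Sg : signature) (f : option Sg) : 0 < join_arity f.
Proof. by case: f => [g|] //=; apply: arity_gt0. Qed.

Definition with_join (Sg : signature) : signature :=
  Signature (@join_arity_gt0 Sg).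

Definition reduct (Sg : signature) (A : algebra (with_join Sg)) : algebra Sg :=
  @Algebra Sg A (fun f args => @interp (with_join Sg) A (Some f) args).

Definition join (Sg : signature) (A : algebra (with_join Sg)) (x y : A) : A :=
  @interp (with_join Sg) A None (fun i : 'I_2 => if i == ord0 then x else y).

Definition update (T : Type) n (x : 'I_n -> T) (i : 'I_n) (a : T) : 'I_n -> T :=
  fun j => if j == i then a else x j.

Definition distributes_over (T : Type) (add : T -> T -> T) n
    (f : ('I_n -> T) -> T) :=
  forall (i : 'I_n) (x : 'I_n -> T) (a b : T),
    f (update x i (add a b)) = add (f (update x i a)) (f (update x i b)).

Definition semilattice (T : Type) (add : T -> T -> T) :=
  [/\ associative add, commutative add & idempotent_op add].

Definition semilattice_ordered (Sg : signature) (A : algebra (with_join Sg)) :=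
  semilattice (@join Sg A) /\
  forall f : Sg, distributes_over (@join Sg A) (@interp Sg (reduct A) f).

(** The class [SV] of the variety [V]; the generating set [X] generates
    [(A, Omega, +)], while only the operations of [Omega] are used to form the
    subalgebra required to lie in [V]. *)
Definition so_class (Sg : signature) (V : algebra Sg -> Prop)
    (A : algebra (with_join Sg)) : Prop :=
  semilattice_ordered A /\
  exists X : A -> Prop,
    generates X /\ V (@generated_subalgebra Sg (reduct A) X).

Definition word_op_distributes (Sg : signature) (A : algebra (with_join Sg)) n
    (t : term Sg n) :=
  distributes_over (@join Sg A) (term_op (reduct A) t).

(* Main.v *)
Require Import Defs.
From mathcomp Require Import all_boot.
From Stdlib Require Import FunctionalExtensionality.

(** An operation that distributes over [+] in every argument is determined by
    its values on tuples of [+]-generators.  If [X] generates [(A, Omega, +)],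
    distributivity of the basic operations lets every [+] inside a term be
    pulled outwards, so each element of [A] is a finite join of elements of the
    full subreduct [<X>_Omega] ([generated_sub_join_closure]).  That subreduct
    lies in [V], hence the word operations of [t] and [u] agree on it
    ([satisfies_on_generated]).  If both distribute over [+], the agreement
    spreads from the subreduct to all its finite joins, that is, to [A].
    Conversely, if [t] and [u] induce the same operation on [A], one distributes
    exactly when the other does.

    Pulling joins out of a basic operation and spreading the agreement of [t]
    and [u] are two instances of one induction principle,
    [join_closure_tuple_ind], which passes from generators to finite joins one
    coordinate at a time. *)

Set Implicit Arguments.
Unset Strict Implicit.
Unset Printing Implicit Defensive.

Inductive join_closure (T : Type) (add : T -> T -> T) (P : T -> Prop) :
    T -> Prop :=
| join_closure_base x : P x -> join_closure add P x
| join_closure_add x y :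
    join_closure add P x -> join_closure add P y ->
    join_closure add P (add x y).

Lemma update_id (T : Type) n (v : 'I_n -> T) (i : 'I_n) :
  update v i (v i) = v.
Proof.
by apply: functional_extensionality => j; rewrite /update; case: eqP => [->|].
Qed.

(** The induction is on the number [k] of leading coordinates allowed to be
    arbitrary joins, the others being elements of [P]; the coordinate that
    becomes free at each stage is then treated by induction on how it is
    built from [P]. *)
Lemma join_closure_tuple_ind (T : Type) (add : T -> T -> T) (P : T -> Prop) n
    (R : ('I_n -> T) -> Prop) :
  (forall v, (forall i, P (v i)) -> R v) ->
  (forall i v a b, R (update v i a) -> R (update v i b) ->
     R (update v i (add a b))) ->
  forall v, (forall i, join_closure add P (v i)) -> R v.
Proof.
move=> RP Radd v v_cl.
suff free_below k w : (forall i, join_closure add P (w i)) ->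
    (forall i : 'I_n, k <= i -> P (w i)) -> R w.
  by apply: (free_below n) => // i; rewrite leqNgt ltn_ord.
elim: k w => [|k IHk] w w_cl wP; first by apply: RP => i; apply: wP.
case: (ltnP k n) => [lt_kn|le_nk]; last first.
  by apply: IHk => // i le_ki; have := leq_trans le_nk le_ki;
    rewrite leqNgt ltn_ord.
pose i0 := Ordinal lt_kn; rewrite -(update_id w i0).
elim: (w_cl i0) => [p Pp|a b _ Ra _ Rb]; last exact: Radd.
apply: IHk => i; rewrite /update.
  by case: eqP => // _; apply: join_closure_base.
case: eqP => // /eqP ne_i le_ki; apply: wP.
by rewrite ltn_neqAle le_ki andbT eq_sym.
Qed.

Lemma interp_None (Sg : signature) (A : algebra (with_join Sg))
    (args : 'I_2 -> A) :
  @interp (with_join Sg) A None args = join (args ord0) (args (lift ord0 ord0)).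
Proof.
congr interp; apply: functional_extensionality => i.
by case: eqP => [->|] //; case: i => -[|[]] //= lt_i ne_i;
  [case: ne_i|congr args]; apply: val_inj.
Qed.

(** Closure under [+] is built in; closure under the basic operations holds
    because they distribute over [+] and preserve [<X>_Omega]. *)
Lemma generated_sub_join_closure (Sg : signature) (A : algebra (with_join Sg))
    (X : A -> Prop) :
  (forall f : Sg, distributes_over (@join Sg A) (@interp Sg (reduct A) f)) ->
  forall a, generated X a ->
    join_closure (@join Sg A) (@generated Sg (reduct A) X) a.
Proof.
move=> distr a; elim=> {a} [x Xx|].
  by apply: join_closure_base; apply: gen_base.
case=> [f|] args _ IHargs; last first.
  by rewrite interp_None; apply: join_closure_add.
apply: (join_closure_tuple_ind (R := fun w =>
  join_closure _ _ (@interp Sg (reduct A) f w)) _ _ IHargs) => [w w_gen|].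
  by apply: join_closure_base; apply: gen_op.
by move=> i w x y Rx Ry; rewrite distr; apply: join_closure_add.
Qed.

Lemma term_op_generated_subalgebra (Sg : signature) (A : algebra Sg)
    (X : A -> Prop) n (t : term Sg n) (w : 'I_n -> generated_subalgebra X) :
  sval (term_op (generated_subalgebra X) t w) =
  term_op A t (fun i => sval (w i)).
Proof.
elim: t => //= f args IHargs; congr interp.
by apply: functional_extensionality => j; apply: IHargs.
Qed.

Lemma satisfies_on_generated (Sg : signature) (A : algebra Sg)
    (X : A -> Prop) n (t u : term Sg n) :
  satisfies (generated_subalgebra X) t u ->
  forall v, (forall i, generated X (v i)) -> term_op A t v = term_op A u v.
Proof.
move=> tu v v_gen.
pose w i : generated_subalgebra X := exist _ (v i) (v_gen i).
have := congr1 sval (tu w).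
by rewrite !term_op_generated_subalgebra.
Qed.

Theorem theorem3p8 (Omega : signature) (V : algebra Omega -> Prop)
    (n : nat) (t u : term Omega n) (S : algebra (with_join Omega) -> Prop)
    (hn : n <> 0)
    (V_variety : variety V)
    (V_tu : class_satisfies V t u)
    (S_variety : variety S)
    (S_sub_SV : forall A, S A -> so_class V A)
    (t_distr : forall A, S A -> word_op_distributes A t) :
  (forall A, S A -> satisfies (reduct A) t u) <->
  (forall A, S A -> word_op_distributes A u).
Proof.
split=> [tu A SA i x a b|u_distr A SA v].
  by rewrite -!(tu A SA); apply: t_distr.
have [[_ distr] [X [X_gen V_X]]] := S_sub_SV A SA.
apply: (join_closure_tuple_ind (add := @join Omega A)
  (P := @generated Omega (reduct A) X)
  (R := fun w => term_op (reduct A) t w = term_op (reduct A) u w)).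
- exact: satisfies_on_generated (V_tu _ V_X).
- by move=> i w a b tu_a tu_b; rewrite t_distr // u_distr // tu_a tu_b.
- by move=> i; apply: generated_sub_join_closure.
Qed.
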